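(* Fix constants $\alpha>0$, $\beta>0$ and $\gamma_P>2$. Let $f(n):=n^{2/3}\ln^{1/3}n$, $s:=\min\{\lceil\alpha f(n)\rceil,n-1\}$ and $g:=(\beta s\ln n)^{1/2}$, and suppose $s<n-1$. Let $c_{nk}$ be the number of comparisons made by the nonrecursive SELECT on an input list of size $n$ with rank $k$, and set $$\hat\gamma_P:=(4\gamma_P+2)(\beta/\alpha)^{1/2}+(2\gamma_P-1)\big[\alpha+1/f(n)\big].$$ Then $$\mathrm{P}\big[c_{nk}\le n+\min\{k,n-k\}+\hat\gamma_P f(n)\big]\ge1-4n^{-2\beta}.$$ The same holds with $f(n)$ in the definition of $\hat\gamma_P$ replaced by $f(3)$. Moreover, if $\beta\ge1/6$, then $$\mathrm{E}\,c_{nk}\le n+\min\{k,n-k\}+(\hat\gamma_P+4\gamma_P+2)f(n).$$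
   Context: Nonrecursive SELECT. The input is a list $X=(x_1,\dots,x_n)$ of elements of a totally ordered set (repeated values allowed) and an integer $1\le k\le n$. Let $\mathcal R$ be a deterministic routine that finds the $i$th smallest of any $m$ elements using at most $\gamma_P m$ comparisons. 1. Choose a set $I$ of $s$ positions uniformly at random among all $s$-subsets of $\{1,\dots,n\}$. The sample is $S=(x_j)_{j\in I}$ with sorted elements $y_1^*\le\dots\le y_s^*$. 2. Set $i_u:=\max\{\lceil ks/n-g\rceil,1\}$ and $i_v:=\min\{\lceil ks/n+g\rceil,s\}$. Compute $u:=y_{i_u}^*$ and $v:=y_{i_v}^*$ using $\mathcal R$ at most twice on at most $s$ elements, so this step uses at most $2\gamma_P s$ comparisons. 3. Partition. Each $x_j$ with $j\notin I$ is compared with the pivots. - If $k<n/2$: $x_j$ is compared with $v$ first, and with $u$ only if $x_j<v$ and $u<v$. - If $k\ge n/2$: $x_j$ is compared with $u$ first, and with $v$ only if $x_j>u$ and $u<v$. Sample elements are not compared. Hence this step uses $c$ comparisons, where $c=n-s$ if $u=v$, $c=(n-s)+|\{j\notin I:x_j<v\}|$ if $u<v$ and $k<n/2$, and $c=(n-s)+|\{j\notin I:x_j>u\}|$ if $u<v$ and $k\ge n/2$. 4. Let $L=\{x<u\}$, $U=\{x=u\}$, $M=\{u<x<v\}$ and $R=\{x>v\}$. - If $|L|<k\le|L\cup U|$, return $u$; if $|L\cup U\cup M|<k\le n-|R|$, return $v$. In either case set $\hat n:=0$. - Otherwise let $\hat X$ be $L$ if $k\le|L|$, else $R$ if $n-|R|<k$,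 else $M$. Let $\hat n:=|\hat X|$ and find the answer in $\hat X$ with $\mathcal R$, using at most $\gamma_P\hat n$ comparisons. The total count $c_{nk}$ consists of the comparisons in steps 2, 3 and 4, so $c_{nk}\le 2\gamma_P s+c+\gamma_P\hat n$. $\mathrm{P}$ and $\mathrm{E}$ are with respect to the random sample. *)

(* Defs.v *)
From HB Require Import structures.
From mathcomp Require Import all_boot all_order all_algebra.
From mathcomp Require Import mathcomp_extra boolp classical_sets reals exp.

Set Implicit Arguments.
Unset Strict Implicit.
Unset Printing Implicit Defensive.

Import Order.TTheory GRing.Theory Num.Theory.
Local Open Scope ring_scope.

Definition fsel {R : realType} (n : nat) : R :=
  (n%:R) `^ (2 / 3) * (ln (n%:R)) `^ (1 / 3).

Definition sample_size {R : realType} (alpha : R) (n : nat) : nat :=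
  minn (absz (Num.ceil (alpha * fsel n))) n.-1.

Definition gap {R : realType} (alpha beta : R) (n : nat) : R :=
  Num.sqrt (beta * (sample_size alpha n)%:R * ln (n%:R)).

Definition idx_u {R : realType} (alpha beta : R) (n k : nat) : nat :=
  let s := sample_size alpha n in
  absz (Num.max (Num.ceil (k%:R * s%:R / n%:R - gap alpha beta n)) 1).

Definition idx_v {R : realType} (alpha beta : R) (n k : nat) : nat :=
  let s := sample_size alpha n in
  absz (Num.min (Num.ceil (k%:R * s%:R / n%:R + gap alpha beta n)) s%:Z).

(* gamma_hat, with the value F used in place of f(n) inside the bracket *)
Definition gamma_hat {R : realType} (alpha beta gammaP F : R) : R :=
  (4 * gammaP + 2) * Num.sqrt (beta / alpha) + (2 * gammaP - 1) * (alpha + 1 / F).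

Section Select.
Context {d : Order.disp_t} {T : orderType d}.

(* i-th smallest (1-indexed) element of a nonempty list *)
Definition order_stat (S : seq T) (i : nat) : option T :=
  if S is y :: _ then Some (nth y (sort <=%O S) i.-1) else None.

(* Number of comparisons c_{nk} made by the nonrecursive SELECT on input X
   with rank k, when the sample positions are I, and when the deterministic
   routine R uses rc l i comparisons to find the i-th smallest of the list l. *)
Definition select_count {R : realType} (alpha beta : R)
  (rc : seq T -> nat -> nat) (n : nat) (X : n.-tuple T) (k : nat)
  (I : {set 'I_n}) : nat :=
  let s := sample_size alpha n in
  let iu := idx_u alpha beta n k in
  let iv := idx_v alpha beta n k in
  let S := [seq tnth X j | j <- enum I] in
  let notS := [seq tnth X j | j <- enum (~: I)] in
  let xs := val X in
  match order_stat S iu, order_stat S iv with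
  | Some u, Some v =>
    let c := if (u < v)%O then
               (if (k.*2 < n)%N then ((n - s) + count (fun x => x < v)%O notS)%N
                else ((n - s) + count (fun x => u < x)%O notS)%N)
             else (n - s)%N in
    let pL := (fun x => x < u)%O in
    let pU := (fun x => x == u) in
    let pM := (fun x => (u < x) && (x < v))%O in
    let pR := (fun x => v < x)%O in
    let nL := count pL xs in
    let nLU := count (fun x => pL x || pU x) xs in
    let nLUM := count (fun x => [|| pL x, pU x | pM x]) xs in
    let nR := count pR xs in
    let step4 :=
      if ((nL < k <= nLU) || (nLUM < k <= n - nR))%N then 0%N
      else if (k <= nL)%N then rc (filter pL xs) k
      else if (n - nR < k)%N then rc (filter pR xs) (k - (n - nR))%N
      else rc (filter pM xs) (k - nLU)%N in
    (rc S iu + rc S iv + c + step4)%N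
  | _, _ => 0%N
  end.

End Select.

Definition prob_sample {R : realType} (n s : nat) (E : {set 'I_n} -> bool) : R :=
  (#|[set I : {set 'I_n} | (#|I| == s) && E I]|)%:R / ('C(n, s))%:R.

Definition expect_sample {R : realType} (n s : nat) (F : {set 'I_n} -> nat) : R :=
  (\sum_(I : {set 'I_n} | #|I| == s) (F I)%:R) / ('C(n, s))%:R.

(* Main.v *)
Require Import Defs.
From mathcomp Require Import all_boot all_order all_algebra.
From mathcomp Require Import boolp functions reals exp.
From mathcomp Require Import topology normedtype sequences derive realfun.
From mathcomp Require Import ring lra zify.
Import Order.TTheory GRing.Theory Num.Theory.
Import numFieldNormedType.Exports.
Set Implicit Arguments.
Unset Strict Implicit.
Unset Printing Implicit Defensive.
Local Open Scope ring_scope.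

(** The number of sampled positions falling in a fixed set [A] is hypergeometric, so by
    Hoeffding's inequality it falls short of its mean [#|A| s / n] by [g] with probability
    at most [exp (- 2 g^2 / s) = n^(-2 beta)]. The positions of the elements below a pivot,
    or above it, depend on the sample, but they range over a chain of sets, to which the
    same bound extends. Hence each of four bad events has probability at most
    [n^(-2 beta)]: [u] or [v] lies on the wrong side of rank [k], or more than [2 w] ranks
    away from it, where [w = g n / s]. Off these events at most [min(k, n-k) + 2 w]
    elements need a second comparison and at most [4 w] elements are left for the final
    call, while [w <= sqrt (beta / alpha) f(n)] because [f(n)^3 = n^2 ln n]. For the
    expectation, two of the bad events cost at most [n] further comparisons in the
    partition, and all four at most [gammaP n] in the final call. *)

(** * Hoeffding's lemma for Bernoulli laws *)

Lemma ler_is_derive (R : realType) (f g df dg : R -> R) (a x : R) :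
  (forall y, is_derive y (1 : R) f (df y)) -> (forall y, is_derive y (1 : R) g (dg y)) ->
  (forall y, a <= y -> df y <= dg y) -> f a <= g a -> a <= x -> f x <= g x.
Proof.
move=> f_df g_dg df_dg fga ax.
have gf_d y : is_derive y (1 : R) (g - f) (dg y - df y) by apply: is_deriveB.
rewrite -subr_ge0; apply: (@le_trans _ _ (g a - f a)); first by rewrite subr_ge0.
apply: (@ger0_derive1_ndecry _ (g - f) a) => // [y|].
  rewrite in_itv/= andbT => /ltW ay.
  by rewrite derive1E derive_val subr_ge0 df_dg.
apply: continuous_subspaceT => y.
by apply: differentiable_continuous; apply/derivable1_diffP; apply: ex_derive.
Qed.

Definition bernoulli_mgf {R : realType} (p x : R) : R := 1 - p + p * expR x.

(* The mean of the exponentially tilted law, which is again Bernoulli: its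
   derivative in [x] is therefore a variance [q (1 - q) <= 1/4]. *)
Definition tilted_mean {R : realType} (p x : R) : R :=
  p * expR x / bernoulli_mgf p x.

Section BernoulliMgf.
Context {R : realType}.
Implicit Types p x : R.

Lemma bernoulli_mgf0 p : bernoulli_mgf p 0 = 1.
Proof. by rewrite /bernoulli_mgf expR0 mulr1 subrK. Qed.

Lemma bernoulli_mgf_gt0 p x : 0 <= p <= 1 -> 0 < bernoulli_mgf p x.
Proof.
move=> /andP[p0 p1]; rewrite /bernoulli_mgf; have ex0 := expR_gt0 x.
have [->|pn0] := eqVneq p 0; first by lra.
by have : 0 < p * expR x; [rewrite mulr_gt0// lt_neqAle eq_sym pn0 | lra].
Qed.

Lemma is_derive_bernoulli_mgf p x :
  is_derive x (1 : R) (bernoulli_mgf p) (p * expR x).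
Proof.
rewrite (_ : bernoulli_mgf p = cst (1 - p) + p \*: expR); last exact/funext.
by apply: is_derive_eq; rewrite add0r.
Qed.

Lemma is_derive_tilted_mean p x : 0 <= p <= 1 ->
  is_derive x (1 : R) (tilted_mean p) (tilted_mean p x * (1 - tilted_mean p x)).
Proof.
move=> p01; have M0 := lt0r_neq0 (bernoulli_mgf_gt0 x p01).
have dMV := is_deriveV M0 (is_derive_bernoulli_mgf p x).
rewrite (_ : tilted_mean p = (p \*: expR) * (fun y => (bernoulli_mgf p y)^-1));
  last exact/funext.
apply: is_derive_eq; rewrite !fctE /= /GRing.scale /=.
by set M := bernoulli_mgf p x in M0 *; field.
Qed.

Lemma is_derive_ln_bernoulli_mgf p x : 0 <= p <= 1 ->
  is_derive x (1 : R) (fun y => ln (bernoulli_mgf p y)) (tilted_mean p x).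
Proof.
move=> p01; have dln := is_derive1_ln (bernoulli_mgf_gt0 x p01).
apply: is_derive_eq (is_derive1_comp dln (is_derive_bernoulli_mgf p x)) _.
by rewrite /tilted_mean mulrC.
Qed.

Lemma tilted_mean_le p x : 0 <= p <= 1 -> 0 <= x -> tilted_mean p x <= p + x / 4.
Proof.
move=> p01; apply: (@ler_is_derive _ (tilted_mean p) (fun y => p + y / 4)
  (fun y => tilted_mean p y * (1 - tilted_mean p y)) (fun=> 4^-1)) => [y|y|y _|].
- exact: is_derive_tilted_mean.
- rewrite (_ : (fun y => _) = cst p + 4^-1 \*: id).
    by apply: is_derive_eq; rewrite add0r /GRing.scale /= mulr1.
  by apply/funext => z; rewrite !fctE /= mulrC.
- by have := sqr_ge0 (tilted_mean p y - 2^-1); nra.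
- by rewrite /tilted_mean bernoulli_mgf0 expR0; lra.
Qed.

Lemma bernoulli_mgf_le_ge0 p x : 0 <= p <= 1 -> 0 <= x ->
  bernoulli_mgf p x <= expR (p * x + x ^+ 2 / 8).
Proof.
move=> p01 x0; rewrite -[leLHS]lnK ?posrE ?bernoulli_mgf_gt0// ler_expR.
move: x0; apply: (@ler_is_derive _ (fun y => ln (bernoulli_mgf p y))
  (fun y => p * y + y ^+ 2 / 8) (tilted_mean p) (fun y => p + y / 4)) => [y|y|y|].
- exact: is_derive_ln_bernoulli_mgf.
- rewrite (_ : (fun y => _) = p \*: id + 8^-1 \*: (id ^+ 2)).
    by apply: is_derive_eq; rewrite /GRing.scale /= !mulr1; field.
  by apply/funext => z; rewrite !fctE /= [z ^+ 2 / 8]mulrC.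
- exact: tilted_mean_le.
- by rewrite bernoulli_mgf0 ln1; lra.
Qed.

Lemma bernoulli_mgf_le p x : 0 <= p <= 1 ->
  bernoulli_mgf p x <= expR (p * x + x ^+ 2 / 8).
Proof.
move=> p01; have [x0|/ltW x0] := leP 0 x; first exact: bernoulli_mgf_le_ge0.
have -> : bernoulli_mgf p x = expR x * bernoulli_mgf (1 - p) (- x).
  rewrite /bernoulli_mgf expRN.
  by have := lt0r_neq0 (expR_gt0 x); move: (expR x) => e e0; field.
have -> : p * x + x ^+ 2 / 8 = x + ((1 - p) * - x + (- x) ^+ 2 / 8) by field.
by rewrite expRD ler_pM2l ?expR_gt0// bernoulli_mgf_le_ge0; lra.
Qed.

End BernoulliMgf.

(** * Uniform random subsets *)

Definition mean_draws {R : numFieldType} {T : finType} (s : nat)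
    (F : {set T} -> R) : R :=
  (\sum_(I : {set T} | #|I| == s) F I) / 'C(#|T|, s)%:R.

Definition prob_draws {R : numFieldType} {T : finType} (s : nat)
    (E : {set T} -> bool) : R :=
  mean_draws s (fun I => (E I)%:R).

Lemma expect_sampleE (R : realType) n s (F : {set 'I_n} -> nat) :
  expect_sample s F = mean_draws s (fun I => (F I)%:R) :> R.
Proof. by rewrite /mean_draws card_ord. Qed.

Lemma prob_sampleE (R : realType) n s (E : {set 'I_n} -> bool) :
  prob_sample s E = prob_draws s E :> R.
Proof.
rewrite /prob_draws /mean_draws card_ord; congr (_ / _).
rewrite -sum1dep_card natr_sum big_mkcondr; apply: eq_bigr => I _.
by case: (E I).
Qed.

Section Draws.
Context {R : numFieldType} {T : finType} (s : nat).
Implicit Types (F G : {set T} -> R) (E : {set T} -> bool).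

Lemma eq_mean_draws F G : (forall I : {set T}, #|I| = s -> F I = G I) ->
  mean_draws s F = mean_draws s G.
Proof. by move=> FG; congr (_ / _); apply: eq_bigr => I /eqP; exact: FG. Qed.

Lemma ler_mean_draws F G : (forall I : {set T}, #|I| = s -> F I <= G I) ->
  mean_draws s F <= mean_draws s G.
Proof.
move=> FG; rewrite ler_wpM2r ?invr_ge0//; apply: ler_sum => I /eqP; exact: FG.
Qed.

Lemma mean_drawsD F G :
  mean_draws s (fun I => F I + G I) = mean_draws s F + mean_draws s G.
Proof. by rewrite /mean_draws big_split mulrDl. Qed.

Lemma mean_drawsZ (a : R) F :
  mean_draws s (fun I => a * F I) = a * mean_draws s F.
Proof. by rewrite /mean_draws -mulr_sumr mulrA. Qed.

Lemma mean_draws_sum (J : finType) (F : J -> {set T} -> R) :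
  mean_draws s (fun I => \sum_j F j I) = \sum_j mean_draws s (F j).
Proof. by rewrite /mean_draws exchange_big/= mulr_suml. Qed.

Lemma mean_draws_cst (a : R) : (s <= #|T|)%N -> mean_draws s (fun _ : {set T} => a) = a.
Proof.
move=> sT; rewrite /mean_draws sumr_const -cardsE card_draws -[a *+ _]mulr_natr mulfK//.
by rewrite pnatr_eq0 -lt0n bin_gt0.
Qed.

Lemma sub_prob_draws E1 E2 : (forall I : {set T}, #|I| = s -> E1 I -> E2 I) ->
  prob_draws s E1 <= prob_draws s E2 :> R.
Proof.
move=> E12; apply: ler_mean_draws => I sI; rewrite ler_nat.
by have := E12 I sI; case: (E1 I) => // ->.
Qed.

Lemma prob_draws_eq0 E : (forall I : {set T}, #|I| = s -> ~~ E I) ->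
  prob_draws s E = 0 :> R.
Proof.
by move=> nE; rewrite /prob_draws /mean_draws big1 ?mul0r// => I /eqP/nE/negbTE->.
Qed.

Lemma prob_drawsU_le E1 E2 :
  prob_draws s (fun I => E1 I || E2 I) <= prob_draws s E1 + prob_draws s E2 :> R.
Proof.
rewrite -mean_drawsD; apply: ler_mean_draws => I _; rewrite -natrD ler_nat.
by case: (E1 I); case: (E2 I).
Qed.

Lemma prob_drawsC E : (s <= #|T|)%N ->
  prob_draws s (fun I => ~~ E I) = 1 - prob_draws s E :> R.
Proof.
move=> sT; apply/eqP; rewrite eq_sym subr_eq -mean_drawsD; apply/eqP.
rewrite -[LHS](mean_draws_cst 1 sT); congr mean_draws; apply/funext => I.
by case: (E I); rewrite ?addr0 ?add0r.
Qed.

Lemma markov_draws (a : R) F : (forall I, 0 <= F I) ->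
  a * prob_draws s (fun I => a <= F I) <= mean_draws s F.
Proof.
move=> F0; rewrite -mean_drawsZ; apply: ler_mean_draws => I _.
by have [aF|_] := boolP (a <= F I); rewrite ?mulr1 ?mulr0.
Qed.

End Draws.

(** * Hoeffding's inequality for hypergeometric laws *)

Lemma leq_ffact_expn m n j : (m <= n)%N -> (m ^_ j * n ^ j <= n ^_ j * m ^ j)%N.
Proof.
move=> mn; elim: j => [|j IHj]; first by rewrite !expn0 !ffactn0.
rewrite !ffactnSr !expnSr mulnACA [leqRHS]mulnACA; apply: leq_mul => //.
nia.
Qed.

Lemma ler_bin_ratio (R : realFieldType) m n j : (m <= n)%N -> (j <= n)%N ->
  'C(m, j)%:R / 'C(n, j)%:R <= (m%:R / n%:R) ^+ j :> R.
Proof.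
move=> mn jn; have [n0|n_gt0] := posnP n.
  by move: jn mn; rewrite n0 !leqn0 => /eqP-> /eqP->; rewrite !bin0 divr1.
rewrite expr_div_n ler_pdivrMr ?ltr0n ?bin_gt0// mulrAC.
rewrite ler_pdivlMr ?exprn_gt0 ?ltr0n// -!natrX -!natrM ler_nat.
rewrite -(leq_pmul2r (fact_gt0 j)) mulnAC bin_ffact -mulnA bin_ffact.
by rewrite [leqRHS]mulnC; apply: leq_ffact_expn.
Qed.

Lemma mul_bin_subset n s j : (j <= s)%N -> (s <= n)%N ->
  ('C(n, s) * 'C(s, j) = 'C(n, j) * 'C(n - j, s - j))%N.
Proof.
move=> js sn; have jn := leq_trans js sn.
have fact0 : (0 < j`! * (s - j)`! * (n - s)`!)%N by rewrite !muln_gt0 !fact_gt0.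
apply/eqP; rewrite -(eqn_pmul2r fact0); apply/eqP; transitivity n`!.
  by rewrite -(bin_fact sn) -(bin_fact js); ring.
have := @bin_fact (n - j) (s - j); rewrite leq_sub2r// subnBA// subnK// => nj_fact.
by rewrite -(bin_fact jn) -nj_fact//; ring.
Qed.

Lemma card_supersets (T : finType) (J : {set T}) s : (#|J| <= s)%N ->
  #|[set I : {set T} | (#|I| == s) && (J \subset I)]| = 'C(#|T| - #|J|, s - #|J|).
Proof.
move=> Js; rewrite -(cardsC J) addKn -cards_draws.
rewrite -(card_in_imset (f := fun I => I :\: J)); last first.
  move=> I1 I2; rewrite !inE => /andP[_ J1] /andP[_ J2] E.
  by rewrite -(setID I1 J) -(setID I2 J) E (setIidPr J1) (setIidPr J2).
apply: eq_card => K; apply/imsetP/idP => [[I]|].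
  rewrite !inE => /andP[/eqP <- JI] ->.
  by rewrite cardsD (setIidPr JI) eqxx andbT -setCS setCK setDE setCI setCK subsetUr.
rewrite inE => /andP[KJ /eqP cK].
have JK : [disjoint K & J] by rewrite disjoints_subset.
exists (K :|: J); last by rewrite setDUl setDv setU0; apply/esym/setDidPl.
by rewrite !inE subsetUr andbT cardsU (disjoint_setI0 JK) cards0 subn0 cK subnK.
Qed.

Lemma sum_bin_draws (T : finType) (A : {set T}) s j : (j <= s)%N ->
  (\sum_(I : {set T} | #|I| == s) 'C(#|A :&: I|, j) =
   'C(#|A|, j) * 'C(#|T| - j, s - j))%N.
Proof.
move=> js.
transitivity (\sum_(I : {set T} | #|I| == s)
   \sum_(J in [set J : {set T} | J \subset A & #|J| == j]) (J \subset I))%N.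
  apply: eq_bigr => I _; rewrite -cards_draws -sum1dep_card big_mkcond [RHS]big_mkcond.
  apply: eq_bigr => J _; rewrite !inE subsetI.
  by case: (J \subset A); case: (J \subset I); case: (#|J| == j).
rewrite exchange_big/= -cards_draws -sum_nat_const; apply: eq_bigr => J.
rewrite inE => /andP[_ /eqP cJ]; rewrite -{1 2}cJ -card_supersets ?cJ//.
rewrite -sum1dep_card [RHS]big_mkcondr; apply: eq_bigr => I _.
by case: (J \subset I).
Qed.

Section Hypergeometric.
Context {R : realFieldType} {T : finType} (A : {set T}) (s : nat).
Hypothesis sT : (s <= #|T|)%N.

Lemma mean_bin_draws j : (j <= s)%N ->
  mean_draws s (fun I => 'C(#|A :&: I|, j)%:R) =
  'C(s, j)%:R * ('C(#|A|, j)%:R / 'C(#|T|, j)%:R) :> R.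
Proof.
move=> js; rewrite /mean_draws -natr_sum sum_bin_draws// mulrA.
have nzC m : (m <= #|T|)%N -> 'C(#|T|, m)%:R != 0 :> R.
  by move=> mT; rewrite pnatr_eq0 -lt0n bin_gt0.
apply/eqP; rewrite eqr_div ?nzC// ?(leq_trans js)//; apply/eqP.
by rewrite -!natrM mulnAC -mulnA -mul_bin_subset//; congr _%:R; ring.
Qed.

(* The hypergeometric law is compared with the binomial one through its factorial
   moments: [E C(H, j) = C(s, j) C(m, j) / C(n, j) <= C(s, j) (m / n)^j]. *)
Lemma mean_exp_draws_le (x : R) : 0 <= x ->
  mean_draws s (fun I => (1 + x) ^+ #|A :&: I|) <= (1 + #|A|%:R / #|T|%:R * x) ^+ s.
Proof.
move=> x0.
have expand (I : {set T}) : #|I| = s ->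
    (1 + x) ^+ #|A :&: I| = \sum_(j < s.+1) x ^+ j * 'C(#|A :&: I|, j)%:R.
  move=> cI; have AIs : (#|A :&: I| <= s)%N by rewrite -cI subset_leq_card// subsetIr.
  rewrite exprDn (big_ord_widen_cond s.+1 predT
    (fun j => 1 ^+ (#|A :&: I| - j) * x ^+ j *+ 'C(#|A :&: I|, j)))//= big_mkcond/=.
  apply: eq_bigr => j _; rewrite expr1n mul1r ltnS mulr_natr.
  by case: leqP => // AIj; rewrite bin_small// mulr0n.
rewrite (eq_mean_draws expand) mean_draws_sum exprDn.
apply: ler_sum => -[j /= js] _; rewrite ltnS in js.
rewrite mean_drawsZ mean_bin_draws// expr1n mul1r exprMn -[leRHS]mulr_natl [leLHS]mulrCA.
rewrite ler_wpM2l// [leRHS]mulrC ler_wpM2l ?exprn_ge0//.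
by rewrite ler_bin_ratio ?max_card// (leq_trans js).
Qed.

End Hypergeometric.

Section HypergeometricTails.
Context {R : realType} {T : finType} (s : nat).
Hypothesis sT : (0 < s <= #|T|)%N.
Implicit Types (A : {set T}) (g l : R).

Lemma hypergeometric_mgf_le A l : 0 <= l ->
  mean_draws s (fun I => expR (l * #|A :&: I|%:R)) <=
  expR (s%:R * (#|A|%:R / #|T|%:R * l + l ^+ 2 / 8)).
Proof.
move=> l0; have el1 : 0 <= expR l - 1 by rewrite subr_ge0 -expR0 ler_expR.
have [s0 leT] := andP sT; pose p : R := #|A|%:R / #|T|%:R.
have p0 : 0 <= p by rewrite divr_ge0.
have p1 : p <= 1.
  by rewrite ler_pdivrMr ?ltr0n ?(leq_trans s0)// mul1r ler_nat max_card.
rewrite (_ : (fun I => _) = fun I : {set T} => (1 + (expR l - 1)) ^+ #|A :&: I|).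
  apply: (le_trans (mean_exp_draws_le _ leT el1)); rewrite expRM_natl.
  rewrite lerXn2r ?nnegrE ?expR_ge0//.
    by rewrite addr_ge0// mulr_ge0.
  by apply: le_trans (bernoulli_mgf_le l _); rewrite /bernoulli_mgf -/p; lra.
by apply/funext => I; rewrite addrC subrK mulrC expRM_natl.
Qed.

Lemma hypergeometric_upper_tail A g : 0 <= g ->
  prob_draws s (fun I => #|A|%:R * s%:R / #|T|%:R + g <= #|A :&: I|%:R) <=
  expR (- (2 * g ^+ 2 / s%:R)).
Proof.
move=> g0; have /andP[s0 _] := sT; have s0R : 0 < s%:R :> R by rewrite ltr0n.
pose p : R := #|A|%:R / #|T|%:R; pose l := 4 * g / s%:R; pose a := p * s%:R + g.
have l0 : 0 <= l by rewrite divr_ge0 ?mulr_ge0// ltW.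
rewrite -(ler_pM2l (expR_gt0 (l * a))).
have chernoff : expR (l * a) * prob_draws s (fun I => a <= #|A :&: I|%:R) <=
    expR (s%:R * (p * l + l ^+ 2 / 8)).
  apply: le_trans (hypergeometric_mgf_le A l0).
  apply: le_trans (markov_draws s (expR (l * a)) (fun I => expR_ge0 _)).
  rewrite ler_pM2l ?expR_gt0//; apply: sub_prob_draws => I _ aAI.
  by rewrite ler_expR ler_wpM2l.
rewrite [_ * s%:R / _]mulrAC -/p -/a; apply: (le_trans chernoff).
rewrite -expRD ler_expR le_eqVlt; apply/orP; left.
by apply/eqP; rewrite /a /l; field; rewrite gt_eqF.
Qed.

Lemma hypergeometric_lower_tail A g : 0 <= g ->
  prob_draws s (fun I => #|A :&: I|%:R <= #|A|%:R * s%:R / #|T|%:R - g) <=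
  expR (- (2 * g ^+ 2 / s%:R)).
Proof.
move=> g0; apply: le_trans (hypergeometric_upper_tail (~: A) g0).
apply: sub_prob_draws => I cI.
have T0 : 0 < #|T|%:R :> R by rewrite ltr0n; case/andP: sT; apply: leq_trans.
have -> : #|~: A|%:R = #|T|%:R - #|A|%:R :> R by rewrite -(cardsC A) natrD addrC addKr.
have -> : #|~: A :&: I|%:R = s%:R - #|A :&: I|%:R :> R.
  by rewrite -cI -(cardsID A I) natrD setDE ![I :&: _]setIC addrC addKr.
have -> : (#|T|%:R - #|A|%:R) * s%:R / #|T|%:R = s%:R - #|A|%:R * s%:R / #|T|%:R :> R.
  by field; rewrite gt_eqF.
lra.
Qed.

(* Off the empty event, apply the lower tail to the smallest [D I0] with at least [K]
   elements: being nested, the other such sets [D I] contain it. *)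
Lemma nested_sets_tail (D : {set T} -> {set T}) (K g : R) : 0 <= g ->
  (forall I J, (D I \subset D J) || (D J \subset D I)) ->
  (forall I : {set T}, #|I| = s -> #|D I :&: I|%:R <= K * s%:R / #|T|%:R - g) ->
  prob_draws s (fun I => K <= #|D I|%:R) <= expR (- (2 * g ^+ 2 / s%:R)).
Proof.
move=> g0 nestedD few_drawn; pose large (I : {set T}) := (#|I| == s) && (K <= #|D I|%:R).
have [I1 large1|none_large] := pickP large; last first.
  rewrite prob_draws_eq0 ?expR_ge0// => I cI.
  by have := none_large I; rewrite /large cI eqxx /= => ->.
case: (arg_minnP (fun I => #|D I|) large1) => I0 /andP[_ KI0] minI0.
apply: le_trans (hypergeometric_lower_tail (D I0) g0).
apply: sub_prob_draws => I cI KI.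
have D0I : D I0 \subset D I.
  have /orP[//|DI0] := nestedD I0 I.
  have /eqP -> // : D I == D I0.
  by rewrite eqEcard DI0 minI0// /large cI eqxx.
apply: (@le_trans _ _ #|D I :&: I|%:R).
  by rewrite ler_nat subset_leq_card// setSI.
by rewrite (le_trans (few_drawn I cI))// lerD2r ler_wpM2r ?invr_ge0// ler_wpM2r.
Qed.

End HypergeometricTails.

(** * Ranks of order statistics of the sample *)

Section OrderStatistics.
Context {d : Order.disp_t} {T : orderType d}.
Implicit Types (l : seq T) (x : T).

Definition nth_smallest x0 l i : T := nth x0 (sort <=%O l) i.-1.

Lemma order_stat_nth_smallest x0 l i : (0 < i <= size l)%N ->
  order_stat l i = Some (nth_smallest x0 l i).
Proof.
case: l i => [|y l] [|i]//= il; rewrite /nth_smallest.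
by congr Some; apply: set_nth_default; rewrite size_sort.
Qed.

Lemma le_nth_smallest x0 l i j : (i <= j)%N -> (0 < j <= size l)%N ->
  (nth_smallest x0 l i <= nth_smallest x0 l j)%O.
Proof.
move=> ij /andP[j0 jl]; apply: (sorted_leq_nth le_trans (@lexx _ _) x0 (sort_le_sorted l));
  by rewrite ?inE ?size_sort; move: (size l) jl => m jm; lia.
Qed.

Lemma count_lt_nth_smallest x0 l i :
  (count (fun x => x < nth_smallest x0 l i)%O l <= i.-1)%N.
Proof.
rewrite -(count_sort <=%O) leqNgt; apply/negP.
by move/(nth_count_lt x0 (sort_le_sorted l)); rewrite ltxx.
Qed.

Lemma count_gt_nth_smallest x0 l i : (0 < i <= size l)%N ->
  (count (fun x => nth_smallest x0 l i < x)%O l <= size l - i)%N.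
Proof.
move=> /andP[i0 il]; rewrite -(count_sort <=%O) -(size_sort <=%O).
set r := sort <=%O l; set y := nth_smallest x0 l i.
rewrite (eq_count (a2 := predC (fun x => x <= y)%O)) => [|x]; last by rewrite /= ltNge.
rewrite -(count_predC (fun x => x <= y)%O r).
suff i_le : (i <= count (fun x => x <= y)%O r)%N by rewrite -addnBAC ?leq_addl.
rewrite leqNgt; apply/negP => lt_i; suff : (y < y)%O by rewrite ltxx.
apply: (@nth_count_gt _ _ y x0 r i.-1 (sort_le_sorted l)).
by rewrite prednK// size_sort il andbT -ltnS prednK.
Qed.

End OrderStatistics.

Definition sample {T : Type} n (X : n.-tuple T) (I : {set 'I_n}) : seq T :=
  [seq tnth X j | j <- enum I].

Section Sample.
Context {T : Type} {n : nat} (X : n.-tuple T).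
Implicit Types (I : {set 'I_n}) (P : pred T).

Lemma size_sample I : size (sample X I) = #|I|.
Proof. by rewrite size_map -cardE. Qed.

Lemma count_sample P I : count P (sample X I) = #|[set j | P (tnth X j)] :&: I|.
Proof.
rewrite count_map -size_filter cardE /enum_mem -filter_predI; congr size.
by apply: eq_filter => j; rewrite !inE.
Qed.

Lemma count_tuple P : count P X = #|[set j | P (tnth X j)]|.
Proof.
rewrite -[in RHS](setIT [set j | _]) -count_sample /sample enum_setT -enumT.
by rewrite map_tnth_enum.
Qed.

Lemma count_sample_le P I : (count P (sample X I) <= count P X)%N.
Proof. by rewrite count_sample count_tuple subset_leq_card// subsetIl. Qed.

Lemma nested_count_tail (R : realType) s (P : {set 'I_n} -> pred T) (K g : R) :
  (0 < s <= n)%N -> 0 <= g ->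
  (forall I J, (forall x, P I x -> P J x) \/ (forall x, P J x -> P I x)) ->
  (forall I, #|I| = s -> (count (P I) (sample X I))%:R <= K * s%:R / n%:R - g) ->
  prob_draws s (fun I => K <= (count (P I) X)%:R) <= expR (- (2 * g ^+ 2 / s%:R)).
Proof.
move=> sn g0 nestedP few_drawn; under eq_fun do rewrite count_tuple.
have sT : (0 < s <= #|'I_n|)%N by rewrite card_ord.
apply: (nested_sets_tail sT) => // [I J|I cI].
  by apply/orP; have [PP|PP] := nestedP I J; [left|right]; apply/subsetP => j;
    rewrite !inE; exact: PP.
by rewrite -count_sample card_ord few_drawn.
Qed.

End Sample.

Section SampleOrderStatistics.
Context {R : realType} {d : Order.disp_t} {T : orderType d} (x0 : T) {n : nat}.
Variables (X : n.-tuple T) (s i : nat) (K g : R).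
Hypotheses (s_bounds : (0 < s <= n)%N) (i_bounds : (0 < i <= s)%N) (g0 : 0 <= g).

Lemma sample_order_stat_lt_tail : i%:R - 1 <= K * s%:R / n%:R - g ->
  prob_draws s (fun I => K <= (count (fun x => x < nth_smallest x0 (sample X I) i)%O X)%:R)
  <= expR (- (2 * g ^+ 2 / s%:R)).
Proof.
move=> iK; apply: (nested_count_tail s_bounds g0
  (P := fun I x => x < nth_smallest x0 (sample X I) i)%O) => [I J|I cI].
  case: (leP (nth_smallest x0 (sample X I) i) (nth_smallest x0 (sample X J) i)).
    by move=> IJ; left => x /lt_le_trans; apply.
  by move=> /ltW JI; right => x /lt_le_trans; apply.
apply: le_trans iK; have [i_gt0 _] := andP i_bounds.
by rewrite -(natrB _ i_gt0) ler_nat subn1 count_lt_nth_smallest.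
Qed.

Lemma sample_order_stat_gt_tail : s%:R - i%:R <= K * s%:R / n%:R - g ->
  prob_draws s (fun I => K <= (count (fun x => nth_smallest x0 (sample X I) i < x)%O X)%:R)
  <= expR (- (2 * g ^+ 2 / s%:R)).
Proof.
move=> iK; apply: (nested_count_tail s_bounds g0
  (P := fun I x => nth_smallest x0 (sample X I) i < x)%O) => [I J|I cI].
  case: (leP (nth_smallest x0 (sample X I) i) (nth_smallest x0 (sample X J) i)).
    by move=> IJ; right => x; exact: le_lt_trans.
  by move=> /ltW JI; left => x; exact: le_lt_trans.
apply: le_trans iK; have [_ i_le_s] := andP i_bounds.
by rewrite -natrB// ler_nat -cI -(size_sample X) count_gt_nth_smallest// size_sample cI.
Qed.

End SampleOrderStatistics.

(** * Cost of the two partitions *)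

Section Partition.
Context {d : Order.disp_t} {T : orderType d}.
Implicit Types (xs unsampled : seq T) (u v : T).

Definition partition_count unsampled n s k u v : nat :=
  if (u < v)%O then
    if (k.*2 < n)%N then (n - s + count (fun x => x < v)%O unsampled)%N
    else (n - s + count (fun x => u < x)%O unsampled)%N
  else (n - s)%N.

Lemma partition_count_le_size unsampled n s k u v :
  (partition_count unsampled n s k u v <= n - s + size unsampled)%N.
Proof.
rewrite /partition_count; case: ifP => _; last by rewrite leq_addr.
by case: ifP => _; rewrite leq_add2l count_size.
Qed.

Lemma partition_count_le (R : realFieldType) unsampled n s k u v (m : R) :
  0 <= m ->
  (count (fun x => x < v)%O unsampled)%:R <= k%:R + m ->
  (count (fun x => u < x)%O unsampled)%:R <= (n - k)%:R + m ->
  (partition_count unsampled n s k u v)%:R <= (n - s)%:R + (minn k (n - k))%:R + m.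
Proof.
move=> m0 lt_v gt_u; rewrite /partition_count; case: ifP => _; last first.
  by rewrite -addrA lerDl addr_ge0.
case: ifP => kn2; rewrite natrD -addrA lerD2l.
- by have -> : minn k (n - k) = k by lia.
- by have -> : minn k (n - k) = (n - k)%N by lia.
Qed.

Definition pivot_is_answer xs k u v : bool :=
  (count (fun x => x < u)%O xs < k <= count (fun x => (x < u)%O || (x == u)) xs)%N ||
  (count (fun x => [|| (x < u)%O, x == u | (u < x) && (x < v)])%O xs < k
     <= size xs - count (fun x => v < x)%O xs)%N.

Definition residual_input xs k u v : seq T :=
  if pivot_is_answer xs k u v then [::]
  else if (k <= count (fun x => x < u)%O xs)%N then [seq x <- xs | (x < u)%O]
  else if (size xs - count (fun x => v < x)%O xs < k)%N then [seq x <- xs | (v < x)%O]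
  else [seq x <- xs | ((u < x) && (x < v))%O].

Definition residual_rank xs k u v : nat :=
  if (k <= count (fun x => x < u)%O xs)%N then k
  else if (size xs - count (fun x => v < x)%O xs < k)%N then
    (k - (size xs - count (fun x => v < x)%O xs))%N
  else (k - count (fun x => (x < u)%O || (x == u)) xs)%N.

Lemma residual_rank_bounds xs k u v :
  (0 < k <= size xs)%N -> ~~ pivot_is_answer xs k u v ->
  (0 < residual_rank xs k u v <= size (residual_input xs k u v))%N.
Proof.
move=> /andP[k0 kn] not_answer; rewrite /residual_input (negbTE not_answer).
move: not_answer; rewrite /pivot_is_answer /residual_rank negb_or.
set nL := count (fun x => x < u)%O xs; set nR := count (fun x => v < x)%O xs.
set nLU := count (fun x => _ || _) xs; set nLUM := count (fun x => [|| _, _ | _]) xs.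
case: ifPn => [kL _|]; first by rewrite size_filter k0.
rewrite -ltnNge => kL; have nRn : (nR <= size xs)%N by rewrite count_size.
case: ifPn => [kR _|]; first by rewrite size_filter -/nR; lia.
rewrite -leqNgt => kR; rewrite kR kL andbT /= -ltnNge -leqNgt => /andP[nLU_k k_nLUM].
rewrite size_filter subn_gt0 nLU_k leq_subLR (leq_trans k_nLUM)//.
rewrite -count_predUI; apply: leq_trans (leq_addr _ _); apply: sub_count => x /=.
by rewrite orbA.
Qed.

Lemma size_residual_input_le xs k u v : (size (residual_input xs k u v) <= size xs)%N.
Proof.
rewrite /residual_input; case: ifP => // _; case: ifP => _; last case: ifP => _;
  by rewrite size_filter count_size.
Qed.

Lemma count_between xs u v : (u < v)%O ->
  (size xs + count (fun x => (u < x) && (x < v))%O xs =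
   count (fun x => u < x)%O xs + count (fun x => x < v)%O xs)%N.
Proof.
move=> uv; rewrite -count_predUI -(count_predT xs); congr addn; apply: eq_count => x /=.
by case: (ltP u x) => //= /le_lt_trans ->.
Qed.

Lemma size_residual_input_slack (R : realFieldType) xs k u v (w : R) :
  (0 < k <= size xs)%N -> 0 <= w -> (u <= v)%O ->
  ~~ ((w < k%:R) && (k <= count (fun x => x < u)%O xs)%N) ->
  ~~ ((w < (size xs - k)%:R) && (size xs - k <= count (fun x => v < x)%O xs)%N) ->
  (count (fun x => u < x)%O xs)%:R <= (size xs - k)%:R + 2 * w ->
  (count (fun x => x < v)%O xs)%:R <= k%:R + 2 * w ->
  (size (residual_input xs k u v))%:R <= 4 * w.
Proof.
move=> /andP[k0 kn] w0 uv u_le v_ge gt_u lt_v; rewrite /residual_input.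
case: ifP => _; first by rewrite mulr_ge0.
case: ifP => [kL|_]; last case: ifP => [kR|_]; rewrite size_filter.
- have k_le_w : k%:R <= w by move: u_le; rewrite kL andbT -leNgt.
  have : (count (fun x => x < u)%O xs)%:R <= (count (fun x => x < v)%O xs)%:R :> R.
    by rewrite ler_nat; apply: sub_count => x /= /lt_le_trans; apply.
  by lra.
- have nk_le_w : (size xs - k)%:R <= w.
    by move: v_ge; rewrite negb_and -leNgt => /orP[//|]; lia.
  have : (count (fun x => v < x)%O xs)%:R <= (count (fun x => u < x)%O xs)%:R :> R.
    by rewrite ler_nat; apply: sub_count => x /=; apply: le_lt_trans.
  by lra.
- move: uv; rewrite le_eqVlt => /predU1P[->|uv].
    by rewrite (@eq_count _ _ pred0) ?count_pred0 ?mulr_ge0// => x /=; case: (ltgtP x v).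
  have := congr1 (GRing.natmul (1 : R)) (count_between xs uv); rewrite !natrD.
  by move: gt_u; rewrite natrB//; lra.
Qed.

End Partition.

(** * Parameters of the algorithm *)

Lemma expR1_le3 (R : realType) : expR 1 <= 3 :> R.
Proof.
have e6 : expR (6^-1 : R) <= 6 / 5.
  have eN6 := expR_ge1Dx (- 6^-1 : R).
  rewrite -[leLHS]invrK -expRN -[leRHS]invrK lef_pV2 ?posrE ?expR_gt0//; lra.
have -> : 1 = 6%:R * 6^-1 :> R by field.
rewrite expRM_natl (le_trans (lerXn2r 6 _ _ e6)) ?nnegrE ?expR_ge0//; lra.
Qed.

Lemma ceil_le_addr1 (R : realType) (x : R) : (Num.ceil x)%:~R <= x + 1.
Proof. by have := ceilB1_lt x; rewrite intrB; lra. Qed.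

Section SelectionScale.
Context {R : realType}.
Implicit Types m n : nat.

Lemma ln_nat_ge0 n : 0 <= ln n%:R :> R.
Proof. by case: n => [|n]; [rewrite ln0 | rewrite ln_ge0// ler1n]. Qed.

Lemma ln_nat_ge1 n : (2 < n)%N -> 1 <= ln n%:R :> R.
Proof.
move=> n2; rewrite -[leLHS]expRK ler_ln ?posrE ?expR_gt0 ?ltr0n//; last exact: leq_trans n2.
by rewrite (le_trans (expR1_le3 R))// (ler_nat R 3).
Qed.

Lemma fsel_cube n : fsel n ^+ 3 = n%:R ^+ 2 * ln n%:R :> R.
Proof.
rewrite /fsel exprMn -!powR_mulrn ?powR_ge0// -!powRrM !mulfVK ?pnatr_eq0//.
by rewrite powRr1 ?ln_nat_ge0.
Qed.

Lemma powR_le_fsel n : (2 < n)%N -> n%:R `^ (2 / 3) <= fsel n :> R.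
Proof.
move=> n2; rewrite /fsel ler_peMr ?powR_ge0//.
by have := ler_powR (ln_nat_ge1 n2) (_ : 0 <= 1 / 3); rewrite powRr0; apply; lra.
Qed.

Lemma fsel_gt0 n : (1 < n)%N -> 0 < fsel n :> R.
Proof.
by move=> n1; rewrite /fsel mulr_gt0// powR_gt0 ?ln_gt0 ?ltr1n// ltr0n ltnW.
Qed.

Lemma fsel_le m n : (m <= n)%N -> fsel m <= fsel n :> R.
Proof.
move=> mn; have mnR : m%:R <= n%:R :> R by rewrite ler_nat.
rewrite /fsel ler_pM ?powR_ge0// ge0_ler_powR ?nnegrE ?ln_nat_ge0//; try lra.
case: m mn mnR => [|m] mn mnR; first by rewrite ln0 ?ln_nat_ge0.
by rewrite ler_ln ?posrE ?ltr0n// (leq_trans _ mn).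
Qed.

Lemma natr_powR_le_fsel n (beta : R) : (2 < n)%N -> 1 / 6 <= beta ->
  n%:R * n%:R `^ (- (2 * beta)) <= fsel n.
Proof.
move=> n2 beta_ge; have n0 : (0 < n)%N := leq_trans (ltn0Sn 1) (ltnW n2).
apply: le_trans (powR_le_fsel n2).
rewrite -[X in X * _]powRr1 ?ler0n// -powRD; last first.
  by apply/implyP => _; rewrite pnatr_eq0 -lt0n.
by rewrite ler_powR ?ler1n//; lra.
Qed.

End SelectionScale.

Definition rank_slack {R : realType} (alpha beta : R) n : R :=
  gap alpha beta n * n%:R / (sample_size alpha n)%:R.

Section SampleSize.
Context {R : realType} (alpha beta : R) (n : nat).
Hypotheses (alpha_gt0 : 0 < alpha) (s_lt : (sample_size alpha n < n.-1)%N).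

Lemma input_size_gt2 : (2 < n)%N.
Proof.
move: s_lt; rewrite /sample_size gtn_min ltnn orbF.
case: n => [|[|[|m]]]//; rewrite /= ltnS leqn0 absz_eq0 => /eqP c0.
have : 0 < alpha * fsel 2 by rewrite mulr_gt0 ?fsel_gt0.
by rewrite -ceil_gt0 c0.
Qed.

Let f_gt0 : 0 < fsel n :> R := fsel_gt0 (ltnW input_size_gt2).

Lemma sample_size_ceil : Posz (sample_size alpha n) = Num.ceil (alpha * fsel n).
Proof.
move: s_lt; rewrite /sample_size gtn_min ltnn orbF => /ltnW/minn_idPl ->.
by rewrite gez0_abs// ceil_ge0 (lt_trans (ltrN10 _))// mulr_gt0.
Qed.

Lemma sample_size_gt0 : (0 < sample_size alpha n)%N.
Proof. by rewrite -ltz_nat sample_size_ceil ceil_gt0 mulr_gt0. Qed.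

Lemma sample_size_bounds : (0 < sample_size alpha n <= n)%N.
Proof. by rewrite sample_size_gt0/= (leq_trans (ltnW s_lt))// leq_pred. Qed.

Lemma sample_size_ge : alpha * fsel n <= (sample_size alpha n)%:R.
Proof. by rewrite (le_trans (ceil_ge _))// -sample_size_ceil. Qed.

Lemma sample_size_le : (sample_size alpha n)%:R <= alpha * fsel n + 1.
Proof. by apply: le_trans (ceil_le_addr1 _); rewrite -sample_size_ceil. Qed.

Lemma rank_slack_le : 0 <= beta ->
  rank_slack alpha beta n <= Num.sqrt (beta / alpha) * fsel n.
Proof.
move=> beta_ge0; set s := sample_size alpha n.
have s0 : 0 < s%:R :> R by rewrite ltr0n sample_size_gt0.
rewrite /rank_slack -/s -(@ler_pXn2r _ 2) ?nnegrE//; last 2 first.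
- by rewrite divr_ge0// mulr_ge0// sqrtr_ge0.
- by rewrite mulr_ge0 ?sqrtr_ge0// ltW.
rewrite expr_div_n (exprMn 2 (gap _ _ _)) (exprMn 2 (Num.sqrt _)) /gap !sqr_sqrtr;
  rewrite ?mulr_ge0 ?invr_ge0 ?ln_nat_ge0 ?(ltW alpha_gt0)//.
rewrite -/s ler_pdivrMr ?exprn_gt0//.
have -> : beta * s%:R * ln n%:R * n%:R ^+ 2 = beta * s%:R * fsel n ^+ 2 * fsel n.
  by rewrite -[RHS]mulrA -exprSr fsel_cube; ring.
have -> : beta / alpha * fsel n ^+ 2 * s%:R ^+ 2 =
    beta * s%:R * fsel n ^+ 2 * (s%:R / alpha) by field; rewrite gt_eqF.
rewrite ler_wpM2l//; first by rewrite mulr_ge0 ?sqr_ge0// mulr_ge0.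
by rewrite ler_pdivlMr// mulrC sample_size_ge.
Qed.

End SampleSize.

Lemma expR_gap_sqr (R : realType) (alpha beta : R) n :
  0 <= beta -> (0 < n)%N -> (0 < sample_size alpha n)%N ->
  expR (- (2 * gap alpha beta n ^+ 2 / (sample_size alpha n)%:R)) =
  n%:R `^ (- (2 * beta)).
Proof.
move=> beta_ge0 n0 s0; rewrite /gap sqr_sqrtr ?mulr_ge0 ?ln_nat_ge0//.
rewrite /powR gt_eqF ?ltr0n//; congr expR.
by field; rewrite pnatr_eq0 -lt0n.
Qed.

Section PivotIndices.
Context {R : realType} (alpha beta : R) (n k : nat).
Local Notation s := (sample_size alpha n).
Local Notation g := (gap alpha beta n).
Local Notation a := (k%:R * s%:R / n%:R : R).
Local Notation w := (rank_slack alpha beta n).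
Hypotheses (s0 : (0 < s)%N) (k_bounds : (0 < k <= n)%N).

Let n_gt0 : 0 < n%:R :> R.
Proof. by case/andP: k_bounds => k0 kn; rewrite ltr0n (leq_trans k0). Qed.

Let g_ge0 : 0 <= g. Proof. exact: sqrtr_ge0. Qed.

Let a_gt0 : 0 < a.
Proof. by case/andP: k_bounds => k0 _; rewrite divr_gt0// mulr_gt0// ltr0n. Qed.

Lemma rank_slack_ge0 : 0 <= w.
Proof. by rewrite divr_ge0// mulr_ge0. Qed.

Lemma rank_slack_scale : w * s%:R / n%:R = g.
Proof. by rewrite divfK ?mulfK ?gt_eqF// ltr0n. Qed.

Lemma idx_u_max : Posz (idx_u alpha beta n k) = Num.max (Num.ceil (a - g)) 1.
Proof. by rewrite gez0_abs// le_max ler01 orbT. Qed.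

Lemma idx_v_min : Posz (idx_v alpha beta n k) = Num.min (Num.ceil (a + g)) s.
Proof.
by rewrite gez0_abs// le_min ceil_ge0 andbT ltr_wpDr// (lt_trans (ltrN10 _)).
Qed.

Lemma idx_u_bounds : (0 < idx_u alpha beta n k <= s)%N.
Proof.
have as_ : a <= s%:R.
  by rewrite ler_pdivrMr// mulrC ler_wpM2l// ler_nat; case/andP: k_bounds.
rewrite -ltz_nat -lez_nat idx_u_max lt_max ltr01 orbT ge_max lez_nat s0 andbT.
by rewrite ceil_le_int; have := g_ge0; change (s%:~R) with (s%:R : R); lra.
Qed.

Lemma idx_v_bounds : (0 < idx_v alpha beta n k <= s)%N.
Proof.
rewrite -ltz_nat -lez_nat idx_v_min ge_min lexx orbT andbT lt_min ltz_nat s0 andbT.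
by rewrite ceil_gt0 ltr_wpDr.
Qed.

Lemma idx_u_ge : a - g <= (idx_u alpha beta n k)%:R.
Proof.
by rewrite (le_trans (ceil_ge _))// -[leRHS]/(Posz _)%:~R idx_u_max ler_int le_max lexx.
Qed.

Lemma idx_u_le : w < k%:R -> (idx_u alpha beta n k)%:R - 1 <= a - g.
Proof.
move=> wk; have ga : 0 < a - g.
  by rewrite -rank_slack_scale -mulrBl -mulrBl divr_gt0// mulr_gt0 ?subr_gt0// ltr0n.
rewrite -[_%:R]/(Posz _)%:~R idx_u_max (max_idPl _); last first.
  by rewrite -gtz0_ge1 ceil_gt0.
by rewrite lerBlDr ceil_le_addr1.
Qed.

Lemma idx_v_le : (idx_v alpha beta n k)%:R - 1 <= a + g.
Proof.
rewrite lerBlDr; apply: le_trans (ceil_le_addr1 _).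
by rewrite -[leLHS]/(Posz _)%:~R idx_v_min ler_int ge_min lexx.
Qed.

Lemma idx_v_ge : w < (n - k)%:R -> a + g <= (idx_v alpha beta n k)%:R.
Proof.
case/andP: k_bounds => _ kn; rewrite natrB// => wnk.
have ags : a + g <= s%:R.
  rewrite -rank_slack_scale -mulrDl -mulrDl ler_pdivrMr// mulrC ler_wpM2l//.
  by lra.
rewrite -[leRHS]/(Posz _)%:~R idx_v_min (min_idPl _) ?ceil_ge//.
by rewrite ceil_le_int.
Qed.

Lemma idx_u_le_idx_v : (idx_u alpha beta n k <= idx_v alpha beta n k)%N.
Proof.
have [/andP[_ us] /andP[v0 _]] := (idx_u_bounds, idx_v_bounds).
rewrite -lez_nat idx_u_max ge_max lez_nat v0 andbT idx_v_min le_min ceil_le/=; last first.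
  by have := g_ge0; lra.
by apply: le_trans (_ : Posz (idx_u alpha beta n k) <= s); rewrite // idx_u_max le_max lexx.
Qed.

End PivotIndices.

(** * Number of comparisons *)

Section Select.
Context {R : realType} (alpha beta gammaP : R) {d : Order.disp_t} {T : orderType d}.
Variables (rc : seq T -> nat -> nat) (x0 : T) (n : nat) (X : n.-tuple T) (k : nat).
Local Notation s := (sample_size alpha n).
Local Notation w := (rank_slack alpha beta n).

Definition pivot_u (I : {set 'I_n}) : T :=
  nth_smallest x0 (sample X I) (idx_u alpha beta n k).

Definition pivot_v (I : {set 'I_n}) : T :=
  nth_smallest x0 (sample X I) (idx_v alpha beta n k).

(* The conditions [w < k] and [w < n - k] exclude the cases where the index of the
   pivot is truncated to [1], respectively to [s]. *)
Definition u_above_rank (I : {set 'I_n}) : bool :=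
  (w < k%:R) && (k <= count (fun x => x < pivot_u I)%O X)%N.

Definition v_below_rank (I : {set 'I_n}) : bool :=
  (w < (n - k)%:R) && (n - k <= count (fun x => pivot_v I < x)%O X)%N.

Definition u_far_below_rank (I : {set 'I_n}) : bool :=
  (n - k)%:R + 2 * w <= (count (fun x => pivot_u I < x)%O X)%:R.

Definition v_far_above_rank (I : {set 'I_n}) : bool :=
  k%:R + 2 * w <= (count (fun x => x < pivot_v I)%O X)%:R.

Definition far_pivot (I : {set 'I_n}) : bool :=
  u_far_below_rank I || v_far_above_rank I.

Definition bad_pivots (I : {set 'I_n}) : bool :=
  [|| far_pivot I, u_above_rank I | v_below_rank I].

Definition typical_count : R :=
  (n + minn k (n - k))%:R + (2 * gammaP - 1) * s%:R + (4 * gammaP + 2) * w.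

Hypotheses (s_bounds : (0 < s <= n)%N) (k_bounds : (0 < k <= n)%N).
Hypotheses (beta_ge0 : 0 <= beta) (gammaP_ge0 : 0 <= gammaP).
Hypothesis rc_linear : forall (l : seq T) (i : nat), (0 < i <= size l)%N ->
  (rc l i)%:R <= gammaP * (size l)%:R.
Local Notation q := (n%:R `^ (- (2 * beta)) : R).

Let s_gt0 : (0 < s)%N. Proof. by case/andP: s_bounds. Qed.
Let k_le_n : (k <= n)%N. Proof. by case/andP: k_bounds. Qed.

Let g_ge0 : 0 <= gap alpha beta n. Proof. exact: sqrtr_ge0. Qed.

Let gap_tail : expR (- (2 * gap alpha beta n ^+ 2 / s%:R)) = q.
Proof. by rewrite expR_gap_sqr// (leq_trans s_gt0)//; case/andP: s_bounds. Qed.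

Let slack_shift (K : R) :
  (K + 2 * w) * s%:R / n%:R = K * s%:R / n%:R + 2 * gap alpha beta n.
Proof. by rewrite -(rank_slack_scale beta s_gt0 k_bounds); ring. Qed.

Let rank_complement :
  (n - k)%:R * s%:R / n%:R = s%:R - k%:R * s%:R / n%:R :> R.
Proof.
rewrite natrB//; field.
by rewrite pnatr_eq0 -lt0n (leq_trans _ k_le_n)//; case/andP: k_bounds.
Qed.

Lemma prob_u_above_rank : prob_draws s u_above_rank <= q.
Proof.
rewrite /u_above_rank; have [wk|_] /= := ltP w k%:R; last first.
  by rewrite prob_draws_eq0 ?powR_ge0.
rewrite -gap_tail; under eq_fun do rewrite -(ler_nat R).
by apply: sample_order_stat_lt_tail; rewrite ?idx_u_bounds// idx_u_le.
Qed.

Lemma prob_v_below_rank : prob_draws s v_below_rank <= q.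
Proof.
rewrite /v_below_rank; have [wnk|_] /= := ltP w (n - k)%:R; last first.
  by rewrite prob_draws_eq0 ?powR_ge0.
rewrite -gap_tail; under eq_fun do rewrite -(ler_nat R).
apply: sample_order_stat_gt_tail; rewrite ?idx_v_bounds// rank_complement.
by have := idx_v_ge s_gt0 k_bounds wnk; lra.
Qed.

Lemma prob_u_far_below_rank : prob_draws s u_far_below_rank <= q.
Proof.
rewrite -gap_tail; apply: sample_order_stat_gt_tail; rewrite ?idx_u_bounds//.
by rewrite slack_shift rank_complement; have := idx_u_ge alpha beta n k; lra.
Qed.

Lemma prob_v_far_above_rank : prob_draws s v_far_above_rank <= q.
Proof.
rewrite -gap_tail; apply: sample_order_stat_lt_tail; rewrite ?idx_v_bounds// slack_shift.
by have := idx_v_le beta s_gt0 k_bounds; lra.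
Qed.

Lemma prob_far_pivot : prob_draws s far_pivot <= 2 * q.
Proof.
rewrite mulr_natl mulr2n; apply: le_trans (prob_drawsU_le _ _ _) _.
exact: lerD prob_u_far_below_rank prob_v_far_above_rank.
Qed.

Lemma prob_bad_pivots : prob_draws s bad_pivots <= 4 * q.
Proof.
have -> : 4 * q = 2 * q + (q + q) by ring.
apply: le_trans (prob_drawsU_le _ _ _) _; apply: lerD prob_far_pivot _.
apply: le_trans (prob_drawsU_le _ _ _) _.
exact: lerD prob_u_above_rank prob_v_below_rank.
Qed.

Section FixedSample.
Variable (I : {set 'I_n}).
Hypothesis cI : #|I| = s.
Local Notation u := (pivot_u I).
Local Notation v := (pivot_v I).

Lemma select_count_pivots :
  select_count alpha beta rc X k I =
  (rc (sample X I) (idx_u alpha beta n k) + rc (sample X I) (idx_v alpha beta n k)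
   + partition_count (sample X (~: I)) n s k u v
   + if pivot_is_answer X k u v then 0
     else rc (residual_input X k u v) (residual_rank X k u v))%N.
Proof.
rewrite /select_count -!/(sample _ _) !(order_stat_nth_smallest x0);
  rewrite ?size_sample ?cI ?idx_u_bounds ?idx_v_bounds//.
rewrite -/u -/v /residual_input /residual_rank /pivot_is_answer size_tuple.
by congr addn; case: ifP => // _; case: ifP => // _; case: ifP.
Qed.

Lemma partition_count_le_slack :
  (partition_count (sample X (~: I)) n s k u v)%:R <=
  (n + minn k (n - k))%:R - s%:R + 2 * w + n%:R * (far_pivot I)%:R.
Proof.
have w0 : 0 <= w := rank_slack_ge0 alpha beta n.
have [_ sn] := andP s_bounds.
have [_|] := boolP (far_pivot I).
  apply: (@le_trans _ _ (n - s + n)%:R).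
    rewrite ler_nat (leq_trans (partition_count_le_size _ _ _ _ _ _))// leq_add2l.
    by rewrite size_sample -[leqRHS]card_ord max_card.
  by rewrite !natrD natrB// mulr1; have := ler0n R (minn k (n - k)); lra.
rewrite negb_or -!ltNge mulr0 addr0 natrD [n%:R + _ - _]addrAC -natrB//.
move=> /andP[far_u far_v].
apply: partition_count_le; [by lra | |].
- by apply: le_trans (ltW far_v); rewrite ler_nat count_sample_le.
- by apply: le_trans (ltW far_u); rewrite ler_nat count_sample_le.
Qed.

Lemma size_residual_input_le_slack :
  (size (residual_input X k u v))%:R <= 4 * w + n%:R * (bad_pivots I)%:R.
Proof.
have w0 : 0 <= w := rank_slack_ge0 alpha beta n.
have [_|] := boolP (bad_pivots I).
  apply: ler_wpDl; first by rewrite mulr_ge0.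
  by rewrite mulr1 ler_nat -[leqRHS](size_tuple X) size_residual_input_le.
rewrite !negb_or -!ltNge mulr0 addr0 => /and3P[/andP[/ltW far_u /ltW far_v] u_le v_ge].
apply: size_residual_input_slack; rewrite ?size_tuple//.
by rewrite le_nth_smallest ?idx_u_le_idx_v// size_sample cI idx_v_bounds.
Qed.

Lemma select_count_le :
  (select_count alpha beta rc X k I)%:R <=
  typical_count + n%:R * (far_pivot I)%:R + gammaP * n%:R * (bad_pivots I)%:R.
Proof.
have pivot_cost i : (0 < i <= s)%N -> (rc (sample X I) i)%:R <= gammaP * s%:R.
  by have := @rc_linear (sample X I) i; rewrite size_sample cI.
have residual_cost : (if pivot_is_answer X k u v then 0
    else rc (residual_input X k u v) (residual_rank X k u v))%:R <=
    gammaP * (4 * w + n%:R * (bad_pivots I)%:R).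
  apply: le_trans (ler_wpM2l gammaP_ge0 size_residual_input_le_slack).
  case: ifPn => [_|unanswered]; first by rewrite mulr_ge0.
  by rewrite rc_linear// residual_rank_bounds ?size_tuple.
rewrite select_count_pivots !natrD /typical_count.
have := pivot_cost _ (idx_u_bounds beta s_gt0 k_bounds).
have := pivot_cost _ (idx_v_bounds beta s_gt0 k_bounds).
have := partition_count_le_slack.
lra.
Qed.

Lemma select_count_le_typical : ~~ bad_pivots I ->
  (select_count alpha beta rc X k I)%:R <= typical_count.
Proof.
move=> good; have := select_count_le; rewrite (negbTE good).
by move: good; rewrite negb_or => /andP[/negbTE-> _]; rewrite !mulr0 !addr0.
Qed.

End FixedSample.

Lemma prob_select_count_le :
  1 - 4 * q <=
  prob_draws s (fun I => (select_count alpha beta rc X k I)%:R <= typical_count).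
Proof.
have [_ sn] := andP s_bounds; have sT : (s <= #|'I_n|)%N by rewrite card_ord.
apply: (@le_trans _ _ (prob_draws s (fun I => ~~ bad_pivots I))).
  by rewrite prob_drawsC// lerD2l lerN2 prob_bad_pivots.
by apply: sub_prob_draws => I cI; apply: select_count_le_typical.
Qed.

Lemma mean_select_count_le :
  mean_draws s (fun I => (select_count alpha beta rc X k I)%:R) <=
  typical_count + (4 * gammaP + 2) * (n%:R * q).
Proof.
have [_ sn] := andP s_bounds; have sT : (s <= #|'I_n|)%N by rewrite card_ord.
apply: le_trans (ler_mean_draws (fun I cI => select_count_le cI)) _.
rewrite 2!mean_drawsD 2!mean_drawsZ mean_draws_cst// -addrA lerD2l.
rewrite (_ : _ * (n%:R * q) = n%:R * (2 * q) + gammaP * n%:R * (4 * q)); last by ring.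
by apply: lerD; rewrite ler_wpM2l ?mulr_ge0 ?prob_far_pivot ?prob_bad_pivots.
Qed.

End Select.

Lemma typical_count_le (R : realType) (alpha beta gammaP F : R) n k :
  0 < alpha -> 0 <= beta -> 2^-1 <= gammaP -> (sample_size alpha n < n.-1)%N ->
  0 < F -> F <= fsel n ->
  typical_count alpha beta gammaP n k <=
  (n + minn k (n - k))%:R + gamma_hat alpha beta gammaP F * fsel n.
Proof.
move=> alpha0 beta0 gammaP2 s_lt F0 Ff.
rewrite /typical_count /gamma_hat -addrA lerD2l addrC [leRHS]mulrDl lerD//.
  by rewrite -mulrA ler_wpM2l ?rank_slack_le//; lra.
rewrite -mulrA ler_wpM2l//; first by lra.
apply: (le_trans (sample_size_le alpha0 s_lt)); rewrite mulrDl lerD2l mul1r mulrC.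
by rewrite ler_pdivlMr// mul1r.
Qed.

Theorem theorem5p1 (R : realType) (alpha beta gammaP : R)
  (d : Order.disp_t) (T : orderType d) (rc : seq T -> nat -> nat)
  (n : nat) (X : n.-tuple T) (k : nat) :
  0 < alpha -> 0 < beta -> 2 < gammaP ->
  (forall (l : seq T) (i : nat), (0 < i <= size l)%N ->
     (rc l i)%:R <= gammaP * (size l)%:R) ->
  (1 <= k <= n)%N ->
  (sample_size alpha n < n.-1)%N ->
  let s := sample_size alpha n in
  let c := select_count alpha beta rc X k in
  let bnd := (n + minn k (n - k))%N in
  prob_sample s (fun I => (c I)%:R <= bnd%:R + gamma_hat alpha beta gammaP (fsel n) * fsel n)
    >= 1 - 4 * (n%:R) `^ (- (2 * beta))
  /\ prob_sample s (fun I => (c I)%:R <= bnd%:R + gamma_hat alpha beta gammaP (fsel 3) * fsel n)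
    >= 1 - 4 * (n%:R) `^ (- (2 * beta))
  /\ (1 / 6 <= beta ->
      expect_sample s (fun I => c I)
        <= bnd%:R + (gamma_hat alpha beta gammaP (fsel n) + 4 * gammaP + 2) * fsel n).
Proof.
move=> alpha0 beta0 gammaP2 rc_linear k_bounds s_lt s c bnd.
have n2 := input_size_gt2 alpha0 s_lt.
have s_bounds := sample_size_bounds alpha0 s_lt.
pose x0 := tnth X (Ordinal (leq_trans (ltn0Sn 2) n2)).
have [beta_ge0 gammaP_ge0] : 0 <= beta /\ 0 <= gammaP by lra.
have prob_ge F : 0 < F -> F <= fsel n -> 1 - 4 * n%:R `^ (- (2 * beta)) <=
    prob_sample s (fun I => (c I)%:R <= bnd%:R + gamma_hat alpha beta gammaP F * fsel n).
  move=> F0 Ff; rewrite prob_sampleE.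
  apply: le_trans (prob_select_count_le x0 X s_bounds k_bounds _ _ rc_linear) _ => //.
  by apply: sub_prob_draws => I _ /le_trans; apply; apply: typical_count_le => //; lra.
split; [|split=> [|beta_ge]].
- by apply: prob_ge; rewrite ?fsel_gt0// ltnW.
- by apply: prob_ge; rewrite ?fsel_gt0 ?fsel_le.
- rewrite expect_sampleE.
  apply: le_trans (mean_select_count_le x0 X s_bounds k_bounds _ _ rc_linear) _ => //.
  rewrite -[gamma_hat _ _ _ _ + _ + _]addrA [(_ + (4 * _ + 2)) * _]mulrDl [leRHS]addrA lerD//.
    by rewrite typical_count_le ?fsel_gt0 ?(ltnW n2)//; lra.
  by rewrite ler_wpM2l ?natr_powR_le_fsel//; lra.
Qed.
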